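(* Let $m=6+12q$ with $q=4d$ for a nonnegative integer $d$. The minimal decomposition of $\mathbb{Z}_2$ for the Fibonacci polynomial $F_m$ is $$\mathbb{Z}_2=\{0\}\sqcup\Bigl(\bigcup_{n\ge 1}\bigcup_{k=0}^{1}M_{n,k}\Bigr)\sqcup(1+2\mathbb{Z}_2),$$ where $M_{n,k}=\bigl((1+4k)2^n+2^{n+3}\mathbb{Z}_2\bigr)\cup\bigl((3+4k)2^n+2^{n+3}\mathbb{Z}_2\bigr)$. Here $\{0\}$ is the set of a fixed point, the $M_{n,k}$'s are the minimal components, and the clopen set $1+2\mathbb{Z}_2$ is the attracting basin of $\{0\}$ and the $M_{n,k}$'s.
   Context: $\mathbb{Z}_2$ is the ring of 2-adic integers with the 2-adic metric. The Fibonacci polynomials are defined by $F_0(x)=0$, $F_1(x)=1$, $F_m(x)=xF_{m-1}(x)+F_{m-2}(x)$ for $m\ge 2$. For a polynomial $f$ over $\mathbb{Z}_2$, a minimal decomposition of $\mathbb{Z}_2$ for $f$ is a decomposition $\mathbb{Z}_2=\mathcal P\sqcup\mathcal M\sqcup\mathcal B$ (some parts possibly empty) in which: $\mathcal P$ is the finite set consisting of all periodic points of $f$; $\mathcal M=\bigsqcup_i\mathcal M_i$ is the union of all (at most countably many) clopen $f$-invariant sets $\mathcal M_i$ (the minimal components), each a finite union of balls, such that each $f:\mathcal M_i\to\mathcal M_i$ is minimal (every orbit is dense in $\mathcal M_i$); and each point of $\mathcal B$ lies in the attracting basin of a periodic orbit or of a minimal subsystem. A point $x$ lies in the attracting basin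 of a set $C$ (a periodic orbit or minimal component) if the distance from $f^n(x)$ to $C$ tends to $0$ as $n\to\infty$; when a part $\mathcal B$ of a decomposition is said to be the attracting basin of several such sets, this means every point of $\mathcal B$ lies in the attracting basin of one of them. *)

(* Defs.v *)
From HB Require Import structures.
From mathcomp Require Import all_boot all_order all_algebra.
From mathcomp Require Import all_classical all_reals topology.

Set Implicit Arguments.
Unset Strict Implicit.
Unset Printing Implicit Defensive.

Import Order.TTheory GRing.Theory Num.Theory.
Import numFieldTopology.Exports.

Local Open Scope classical_set_scope.
Local Open Scope ring_scope.

(* The ring of 2-adic integers, as the inverse limit of the Z / 2^n Z: an
   element is the sequence of its residues mod 2^n, each represented by the
   natural number in [0, 2^n). *)

Record dyadic := Dyadic {
  residue : nat -> nat;
  residue_coherent : forall n, (residue n.+1 %% 2 ^ n = residue n)%N }.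

Lemma dyadicP (x y : dyadic) : residue x =1 residue y -> x = y.
Proof.
case: x y => [u hu] [v hv] /= /funext uv; case: _ / uv hv => hv.
by congr Dyadic; exact: Prop_irrelevance.
Qed.

HB.instance Definition _ := gen_eqMixin dyadic.
HB.instance Definition _ := gen_choiceMixin dyadic.

Section DyadicRing.
Local Open Scope nat_scope.
Implicit Types (x y z : dyadic) (n : nat).

Lemma residue_mod x n : residue x n %% 2 ^ n = residue x n.
Proof. by rewrite -(residue_coherent x n) modn_mod. Qed.

Lemma residue_lt x n : residue x n < 2 ^ n.
Proof. by rewrite -residue_mod ltn_mod expn_gt0. Qed.

Lemma modn_pow2S m n : m %% 2 ^ n.+1 %% 2 ^ n = m %% 2 ^ n.
Proof. by rewrite modn_dvdm // expnS dvdn_mull. Qed.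

Lemma dyadic_of_nat_coherent k n : k %% 2 ^ n.+1 %% 2 ^ n = k %% 2 ^ n.
Proof. exact: modn_pow2S. Qed.
Definition dyadic_of_nat k := Dyadic (dyadic_of_nat_coherent k).

Lemma dyadic_add_coherent x y n :
  (residue x n.+1 + residue y n.+1) %% 2 ^ n.+1 %% 2 ^ n
  = (residue x n + residue y n) %% 2 ^ n.
Proof. by rewrite modn_pow2S -modnDm !residue_coherent. Qed.
Definition dyadic_add x y := Dyadic (dyadic_add_coherent x y).

Lemma dyadic_mul_coherent x y n :
  (residue x n.+1 * residue y n.+1) %% 2 ^ n.+1 %% 2 ^ n
  = (residue x n * residue y n) %% 2 ^ n.
Proof. by rewrite modn_pow2S -modnMm !residue_coherent. Qed.
Definition dyadic_mul x y := Dyadic (dyadic_mul_coherent x y).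

Lemma dyadic_opp_coherent x n :
  (2 ^ n.+1 - residue x n.+1) %% 2 ^ n.+1 %% 2 ^ n
  = (2 ^ n - residue x n) %% 2 ^ n.
Proof.
rewrite modn_pow2S; apply/eqP; rewrite -(eqn_modDr (residue x n.+1)).
rewrite subnK; last exact/ltnW/residue_lt.
rewrite -[in X in _ == X]modnDmr residue_coherent subnK; last first.
  exact/ltnW/residue_lt.
by rewrite modnn expnS modnMl.
Qed.
Definition dyadic_opp x := Dyadic (dyadic_opp_coherent x).

Lemma dyadic_addA : associative dyadic_add.
Proof. by move=> x y z; apply: dyadicP => n /=; rewrite modnDmr modnDml addnA. Qed.

Lemma dyadic_addC : commutative dyadic_add.
Proof. by move=> x y; apply: dyadicP => n /=; rewrite addnC. Qed.

Lemma dyadic_add0 : left_id (dyadic_of_nat 0) dyadic_add.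
Proof. by move=> x; apply: dyadicP => n /=; rewrite mod0n residue_mod. Qed.

Lemma dyadic_addN : left_inverse (dyadic_of_nat 0) dyadic_opp dyadic_add.
Proof.
move=> x; apply: dyadicP => n /=.
by rewrite modnDml subnK ?modnn ?mod0n //; exact/ltnW/residue_lt.
Qed.

Lemma dyadic_mulA : associative dyadic_mul.
Proof. by move=> x y z; apply: dyadicP => n /=; rewrite modnMmr modnMml mulnA. Qed.

Lemma dyadic_mulC : commutative dyadic_mul.
Proof. by move=> x y; apply: dyadicP => n /=; rewrite mulnC. Qed.

Lemma dyadic_mul1 : left_id (dyadic_of_nat 1) dyadic_mul.
Proof.
by move=> x; apply: dyadicP => n /=; rewrite modnMml mul1n residue_mod.
Qed.

Lemma dyadic_mulDl : left_distributive dyadic_mul dyadic_add.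
Proof.
by move=> x y z; apply: dyadicP => n /=; rewrite modnMml modnDm mulnDl.
Qed.

Lemma dyadic_1neq0 : dyadic_of_nat 1 != dyadic_of_nat 0.
Proof. by apply/eqP => /(congr1 (residue^~ 1)). Qed.

End DyadicRing.

HB.instance Definition _ := GRing.isZmodule.Build dyadic
  dyadic_addA dyadic_addC dyadic_add0 dyadic_addN.

HB.instance Definition _ := GRing.Zmodule_isComNzRing.Build dyadic
  dyadic_mulA dyadic_mulC dyadic_mul1 dyadic_mulDl dyadic_1neq0.

Lemma residueD (x y : dyadic) n :
  residue (x + y) n = ((residue x n + residue y n) %% 2 ^ n)%N.
Proof. by []. Qed.

Lemma residueM (x y : dyadic) n :
  residue (x * y) n = ((residue x n * residue y n) %% 2 ^ n)%N.
Proof. by []. Qed.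

Lemma residueN (x : dyadic) n :
  residue (- x) n = ((2 ^ n - residue x n) %% 2 ^ n)%N.
Proof. by []. Qed.

Lemma residue0 n : residue 0 n = 0%N.
Proof. by rewrite /= mod0n. Qed.

Lemma residue_nat k n : residue k%:R n = (k %% 2 ^ n)%N.
Proof.
elim: k => [|k IH]; first by rewrite mulr0n residue0 mod0n.
by rewrite -addn1 natrD residueD IH /= modnDm.
Qed.

Lemma residueN_eq0 (x : dyadic) n : (residue (- x) n == 0%N) = (residue x n == 0%N).
Proof.
have half (y : dyadic) : residue y n = 0%N -> residue (- y) n = 0%N.
  by move=> y0; rewrite residueN y0 subn0 modnn.
by apply/eqP/eqP => [/half|/half //]; rewrite opprK.
Qed.

Lemma residueD_eq0 (x y : dyadic) n :
  residue x n = 0%N -> residue y n = 0%N -> residue (x + y) n = 0%N.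
Proof. by move=> x0 y0; rewrite residueD x0 y0 mod0n. Qed.

Lemma residue_eq0_le (x : dyadic) m n :
  (m <= n)%N -> residue x n = 0%N -> residue x m = 0%N.
Proof.
move=> /subnK <-; elim: (n - m)%N => [//|k IH]; rewrite addSn => xk0.
by apply: IH; rewrite -residue_coherent xk0 mod0n.
Qed.

Lemma dyadic_eq0 (x : dyadic) : (forall n, residue x n = 0%N) -> x = 0.
Proof. by move=> x0; apply: dyadicP => n; rewrite x0 residue0. Qed.

(* The least n such that x is nonzero mod 2^(n+1) is the largest n such that
   2^n divides x, i.e. the valuation of x. *)
Definition dyadic_abs (R : realType) (x : dyadic) : R :=
  if pselect (exists n, residue x n.+1 != 0%N) is left xn
  then 2^-1 ^+ ex_minn xn else 0.

Definition dyadic_dist (R : realType) (x y : dyadic) : R := dyadic_abs R (x - y).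

Section DyadicMetric.
Variable R : realType.
Implicit Types x y z : dyadic.

Local Notation abs := (dyadic_abs R).
Local Notation dist := (dyadic_dist R).

Lemma dyadic_absP x :
  (x = 0 /\ abs x = 0) \/
  exists n, [/\ abs x = 2^-1 ^+ n, residue x n = 0%N & residue x n.+1 != 0%N].
Proof.
rewrite /dyadic_abs; case: pselect => [xn|xn]; last first.
  left; split=> //; apply: dyadic_eq0 => -[|n].
    by have := residue_lt x 0; rewrite expn0 ltnS leqn0 => /eqP.
  by apply/eqP/negP => /negP xn0; apply: xn; exists n.
right; case: ex_minnP => n n0 nmin; exists n; split=> //.
case: n n0 nmin => [|n] n0 nmin.
  by have := residue_lt x 0; rewrite expn0 ltnS leqn0 => /eqP.
by apply/eqP/negP => /negP /nmin; rewrite ltnn.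
Qed.

Lemma dyadic_abs_le x n : (abs x <= 2^-1 ^+ n) = (residue x n == 0%N).
Proof.
have lt1 : (2^-1 : R) < 1 by rewrite invf_lt1 ?ltr1n.
have gt0 : 0 < (2^-1 : R) by rewrite invr_gt0.
case: (dyadic_absP x) => [[-> ->]|[m [-> xm xSm]]].
  by rewrite residue0 eqxx exprn_ge0 // ltW.
rewrite ler_iXn2l //; apply/idP/eqP => [nm|xn]; first exact: residue_eq0_le nm xm.
rewrite leqNgt; apply/negP => mn; move: xSm.
by rewrite (residue_eq0_le mn xn).
Qed.

Lemma dyadic_abs_ge0 x : 0 <= abs x.
Proof.
by case: (dyadic_absP x) => [[_ ->]|[n [-> _ _]]] //; rewrite exprn_ge0 // invr_ge0.
Qed.

Lemma dyadic_abs_eq0 x : abs x = 0 -> x = 0.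
Proof.
move=> x0; apply: dyadic_eq0 => n; apply/eqP.
by rewrite -dyadic_abs_le x0 exprn_ge0 // invr_ge0.
Qed.

Lemma dyadic_abs0 : abs 0 = 0.
Proof.
case: (dyadic_absP 0) => [[] //|[n [_ _]]]; first by rewrite residue0.
Qed.

Lemma dyadic_abs_leP x y :
  (forall n, residue y n = 0%N -> residue x n = 0%N) -> abs x <= abs y.
Proof.
move=> xy; case: (dyadic_absP y) => [[y0 ->]|[n [-> yn _]]].
  rewrite (_ : x = 0) ?dyadic_abs0 //; apply: dyadic_eq0 => n.
  by apply: xy; rewrite y0 residue0.
by rewrite dyadic_abs_le xy.
Qed.

Lemma dyadic_absN x : abs (- x) = abs x.
Proof.
by apply/eqP; rewrite eq_le !dyadic_abs_leP // => n /eqP;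
  rewrite ?residueN_eq0 => x0; apply/eqP; rewrite ?residueN_eq0.
Qed.

Lemma dyadic_absD x y : abs (x + y) <= Num.max (abs x) (abs y).
Proof.
wlog le_xy : x y / abs x <= abs y => [H|].
  case: (leP (abs x) (abs y)) => [xy|/ltW yx].
    by have := H _ _ xy; rewrite (max_idPr xy).
  by have := H _ _ yx; rewrite addrC (max_idPr yx).
rewrite (max_idPr le_xy); apply: dyadic_abs_leP => n yn.
apply: residueD_eq0 => //; apply/eqP; rewrite -dyadic_abs_le.
by apply: le_trans le_xy _; rewrite dyadic_abs_le yn.
Qed.

Lemma dyadic_dist_ultra x y z : dist x z <= Num.max (dist x y) (dist y z).
Proof. by rewrite /dyadic_dist -(subrKA y) dyadic_absD. Qed.

Lemma dyadic_dist_sym x y : dist x y = dist y x.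
Proof. by rewrite /dyadic_dist -dyadic_absN opprB. Qed.

Lemma dyadic_distxx x : dist x x = 0.
Proof. by rewrite /dyadic_dist subrr dyadic_abs0. Qed.

Lemma dyadic_dist_ge0 x y : 0 <= dist x y.
Proof. exact: dyadic_abs_ge0. Qed.

Lemma dyadic_dist_eq0 x y : dist x y = 0 -> x = y.
Proof. by move=> /dyadic_abs_eq0 /eqP; rewrite subr_eq0 => /eqP. Qed.

End DyadicMetric.

(* The uniform structure does not mention the real numbers; the metric
   instances below, one for each realType, are compatible with it. *)
Definition dyadic_entourage : set_system (dyadic * dyadic) :=
  [set E | exists n, forall x y, residue (x - y) n = 0%N -> E (x, y)].

Section DyadicUniform.
Local Open Scope relation_scope.
Implicit Types A E : set (dyadic * dyadic).

Lemma dyadic_entourage_filter : Filter dyadic_entourage.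
Proof.
split.
- by exists 0%N.
- move=> P Q [m Pm] [n Qn]; exists (maxn m n) => x y xy.
  split; [apply: Pm | apply: Qn]; apply: residue_eq0_le xy.
    exact: leq_maxl.
  exact: leq_maxr.
- by move=> P Q PQ [n Pn]; exists n => x y /Pn /PQ.
Qed.

Lemma dyadic_entourage_diagonal A : dyadic_entourage A -> diagonal `<=` A.
Proof.
move=> [n An] [x y] xy; apply: An.
by rewrite (xy : x = y) subrr residue0.
Qed.

Lemma dyadic_entourage_inv A : dyadic_entourage A -> dyadic_entourage A^-1.
Proof.
move=> [n An]; exists n => x y xy; apply: An.
by apply/eqP; rewrite -residueN_eq0 opprB xy.
Qed.

Lemma dyadic_entourage_split A : dyadic_entourage A ->
  exists2 B, dyadic_entourage B & B \; B `<=` A.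
Proof.
move=> [n An]; exists [set p | residue (p.1 - p.2) n = 0%N]; first by exists n.
move=> [x z] [y /= xy yz]; apply: An.
by rewrite -(subrKA y); exact: residueD_eq0.
Qed.

End DyadicUniform.

HB.instance Definition _ := isUniform.Build dyadic
  dyadic_entourage_filter dyadic_entourage_diagonal
  dyadic_entourage_inv dyadic_entourage_split.

Section DyadicPseudoMetric.
Variable R : realType.

Definition dyadic_ball (x : dyadic) (e : R) : set dyadic :=
  [set y | dyadic_dist R x y < e].

Lemma dyadic_ball_center (x : dyadic) (e : R) : 0 < e -> dyadic_ball x e x.
Proof. by rewrite /dyadic_ball /= dyadic_distxx. Qed.

Lemma dyadic_ball_sym (x y : dyadic) (e : R) :
  dyadic_ball x e y -> dyadic_ball y e x.
Proof. by rewrite /dyadic_ball /= dyadic_dist_sym. Qed.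

Lemma dyadic_ball_triangle (x y z : dyadic) (e1 e2 : R) :
  dyadic_ball x e1 y -> dyadic_ball y e2 z -> dyadic_ball x (e1 + e2) z.
Proof.
rewrite /dyadic_ball /= => xy yz.
apply: le_lt_trans (dyadic_dist_ultra _ x y z) _.
rewrite gt_max; apply/andP; split; apply: lt_le_trans.
- exact: xy.
- by rewrite lerDl (le_trans (dyadic_dist_ge0 R y z)) // ltW.
- exact: yz.
- by rewrite lerDr (le_trans (dyadic_dist_ge0 R x y)) // ltW.
Qed.

Lemma dyadic_entourageE :
  @entourage dyadic = entourage_ dyadic_ball.
Proof.
rewrite predeqE => E; split=> [[n En]|[e /= e0 eE]].
  exists (2^-1 ^+ n); first by rewrite /= exprn_gt0 // invr_gt0.
  by move=> [x y] /= /ltW; rewrite dyadic_abs_le => /eqP /En.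
have [n ne] : exists n, (2^-1 : R) ^+ n < e.
  exists (Num.bound e^-1); rewrite exprVn -[ltRHS]invrK ltf_pV2 ?posrE.
  - apply: lt_le_trans (_ : (Num.bound e^-1)%:R <= _).
      by apply: archi_boundP; rewrite invr_ge0 ltW.
    by rewrite -natrX ler_nat ltnW // ltn_expl.
  - by rewrite exprn_gt0.
  - by rewrite invr_gt0.
exists n => x y xy; apply: eE => /=.
by apply: le_lt_trans ne; rewrite dyadic_abs_le xy.
Qed.

HB.instance Definition _ := Uniform_isPseudoMetric.Build R dyadic
  dyadic_ball_center dyadic_ball_sym dyadic_ball_triangle dyadic_entourageE.

Lemma dyadic_ballE (x : dyadic) (e : R) :
  ball x e = [set y | dyadic_dist R x y < e].
Proof. by []. Qed.

HB.instance Definition _ := PseudoMetric_isMetric.Build R dyadic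
  (dyadic_dist_ge0 R) (@dyadic_dist_eq0 R) dyadic_ballE.

End DyadicPseudoMetric.

Section Dynamics.
Context {R : realType} {T : metricType R}.
Implicit Types (f : T -> T) (x : T) (A C P B : set T).

Definition forward_orbit f x : set T := [set iter n f x | n in [set: nat]].

Definition periodic_points f : set T :=
  [set x | exists2 n, (0 < n)%N & iter n f x = x].

Definition periodic_orbit f C : Prop :=
  exists2 x, periodic_points f x & C = forward_orbit f x.

Definition finite_union_of_balls A : Prop :=
  exists S : set (T * R), [/\ finite_set S, forall p, S p -> 0 < p.2 &
    A = \bigcup_(p in S) ball p.1 p.2].

(* The empty set is excluded: it would vacuously be a minimal component. *)
Record minimal_component f C : Prop := MinimalComponent {
  mc_nonempty : C !=set0;
  mc_clopen : clopen C;
  mc_invariant : f @` C `<=` C;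
  mc_balls : finite_union_of_balls C;
  mc_minimal : forall x, C x -> C `<=` closure (forward_orbit f x) }.

Definition dist_set x C : R := inf [set mdist x c | c in C].

Definition attracting_basin f C : set T :=
  [set x | dist_set (iter n f x) C @[n --> \oo] --> (0 : R)].

(* The minimal components are listed, without repetition, by the family
   (M i) indexed by i in D: the M i are nonempty, so that trivIset also forces
   distinct indices to give distinct components. *)
Record minimal_decomposition f P {I : Type} (D : set I) (M : I -> set T) B
    : Prop := MinimalDecomposition {
  md_cover : P `|` (\bigcup_(i in D) M i) `|` B = setT;
  md_disjPM : P `&` (\bigcup_(i in D) M i) = set0;
  md_disjPB : P `&` B = set0;
  md_disjMB : (\bigcup_(i in D) M i) `&` B = set0;
  md_finite : finite_set P;
  md_periodic : P = periodic_points f;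
  md_countable : countable D;
  md_trivIset : trivIset D M;
  md_components : [set C | minimal_component f C] = M @` D;
  md_basin : forall x, B x -> exists C,
    (periodic_orbit f C \/ minimal_component f C) /\ attracting_basin f C x }.

End Dynamics.

Fixpoint fib_poly (A : nzRingType) (m : nat) : {poly A} :=
  match m with
  | 0 => 0
  | 1 => 1
  | (k.+1 as l).+1 => 'X * fib_poly A l + fib_poly A k
  end.

(* a + 2^n Z_2 *)
Definition dyadic_coset (a : dyadic) (n : nat) : set dyadic :=
  [set a + 2 ^+ n * z | z in [set: dyadic]].

Definition M_set (n k : nat) : set dyadic :=
  dyadic_coset ((1 + 4 * k)%:R * 2 ^+ n) (n + 3) `|`
  dyadic_coset ((3 + 4 * k)%:R * 2 ^+ n) (n + 3).

(* Main.v *)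
Require Import Defs.
From HB Require Import structures.
From mathcomp Require Import all_boot all_order all_algebra.
From mathcomp Require Import all_classical all_reals topology.
From mathcomp Require Import ring zify.

Set Implicit Arguments.
Unset Strict Implicit.

Import Order.TTheory GRing.Theory Num.Theory.
Import numFieldTopology.Exports.

Local Open Scope classical_set_scope.
Local Open Scope ring_scope.

(** Write h = m / 2, so that h = 3 + 24 d.  The recurrence gives
    F_m = h X + C(h + 1, 3) X^3 + X^5 P, and C(h + 1, 3) is divisible by 4.
    Hence f = F_m multiplies differences of even points by a factor congruent
    to h modulo 16 ([fib_poly_slope_even]).  Two things follow.

    On the sphere of the points of valuation n >= 1, f acts as multiplication
    by a unit congruent to 3 modulo 8, so it preserves the sphere and exchanges
    the classes 1 and 3, and the classes 5 and 7, of the unit part modulo 8.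
    This makes M_(n,0) and M_(n,1) invariant ([tripling_swap]).

    As h^2 is congruent to 9 modulo 16, the second iterate moves every point of
    that sphere by an odd multiple of 2^(n+3), and its slopes are congruent to 1
    modulo 4.  These two properties are inherited, with n + 3 replaced by n + 4,
    by the square of the map ([odometer_sqr]).  Iterating this doubling, the
    orbit of x under the second iterate meets every class modulo 2^(n+3+N) that
    is congruent to x modulo 2^(n+3) ([odometer_dense]), and it never returns to
    x ([odometer_aperiodic]).  As f exchanges the two cosets of M_(n,k), each
    M_(n,k) is minimal; moreover 0 is the only even periodic point.

    Finally F_m(1) is even because 3 divides m, so f sends odd points to even
    ones: every orbit enters {0} or some M_(n,k) after one step.  This
    gives the basin.  It also gives the completeness of the list: a minimal
    component contains an even point, it cannot contain the fixed point 0, which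
    is not isolated, so it meets some M_(n,k), and two minimal components that
    meet are equal. *)

(** * Divisibility by powers of two in the dyadic integers *)

(** The coherence condition of the quotient of [x] by [2 ^ n], whose residue
    modulo [2 ^ k] is read off the residue of [x] modulo [2 ^ (n + k)]. *)
Lemma dyadic_shift_coherent (x : dyadic) n k :
  (residue x (n + k.+1) %/ 2 ^ n %% 2 ^ k = residue x (n + k) %/ 2 ^ n)%N.
Proof. by rewrite modn_divl -expnD (addnC k) addnS residue_coherent. Qed.

Lemma residue_eq0P (x : dyadic) n :
  residue x n = 0%N <-> exists z, x = 2 ^+ n * z.
Proof.
split=> [x0|[z ->]]; last first.
  by rewrite residueM -natrX residue_nat modnn mul0n mod0n.
exists (Dyadic (dyadic_shift_coherent x n)).
apply: dyadicP => k; rewrite residueM -natrX residue_nat modnMml /=.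
have le2 : (2 ^ n %| residue x (n + k))%N.
  elim: k => [|k IH]; first by rewrite addn0 x0 dvdn0.
  rewrite addnS (divn_eq (residue x _) (2 ^ (n + k))) residue_coherent.
  by rewrite dvdn_addr // expnD mulnCA dvdn_mulr.
rewrite mulnC divnK //; elim: n {x0 le2} => [|n IH]; first by rewrite residue_mod.
rewrite IH addSn -(residue_coherent x (n + k)) modn_dvdm //.
by rewrite dvdn_exp2l // leq_addl.
Qed.

Lemma dyadic_parity (x : dyadic) : exists z, x = 2 * z \/ x = 1 + 2 * z.
Proof.
have := residue_lt x 1; rewrite expn1.
case E : (residue x 1) => [|[|//]] _.
  by have /residue_eq0P[z ->] := E; exists z; left; rewrite expr1.
have /residue_eq0P[z xz] : residue (x - 1) 1 = 0%N.
  by rewrite residueD E residueN (residue_nat 1).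
by exists z; right; rewrite -[LHS](subrK 1) xz expr1 addrC.
Qed.

Lemma dyadic_odd_neq0 (z : dyadic) : 1 + 2 * z <> 0.
Proof.
move=> /(congr1 (residue^~ 1%N)).
by rewrite residue0 residueD residueM !residue_nat modnn mul0n.
Qed.

(** The residue of [2 * z] modulo [2 ^ k.+1] is twice that of [z] modulo
    [2 ^ k]. *)
Lemma dyadic_lreg2X n : GRing.lreg (2 ^+ n : dyadic).
Proof.
apply/lregX/mulrI0_lreg => z z0; apply: dyadic_eq0 => k.
have /eqP := congr1 (residue^~ k.+1) z0.
rewrite residue0 residueM residue_nat modnMml expnS -muln_modr muln_eq0 /=.
by rewrite residue_coherent => /eqP.
Qed.

(** The sphere of the points of valuation [n]. *)
Definition dyadic_shell n : set dyadic :=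
  [set x | exists z, x = 2 ^+ n * (1 + 2 * z)].

Lemma dyadic_shell_neq0 n x : dyadic_shell n x -> x <> 0.
Proof.
move=> [z ->] z0; apply: (@dyadic_odd_neq0 z).
by apply: (@dyadic_lreg2X n); rewrite z0 mulr0.
Qed.

Lemma dyadic_neq0_shell (x : dyadic) : x <> 0 -> exists n, dyadic_shell n x.
Proof.
move=> x0; have xn : exists n, residue x n != 0%N.
  apply: contra_notP x0 => /forallNP x0; apply: dyadic_eq0 => n.
  by apply/eqP; rewrite -[_ == _]negbK; exact/negP.
case: (ex_minnP xn) => -[|n] {}xn nmin.
  by have := residue_lt x 0; rewrite expn0 ltnS leqn0 (negPf xn).
have /residue_eq0P[y xy] : residue x n = 0%N.
  by apply/eqP/negPn/negP => /nmin; rewrite ltnn.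
exists n; have [z [yz|yz]] := dyadic_parity y; last by exists z; rewrite xy yz.
case/eqP: xn; apply/residue_eq0P; exists z.
by rewrite xy yz exprSr mulrA.
Qed.

Lemma dyadic_shell_inj m n x : dyadic_shell m x -> dyadic_shell n x -> m = n.
Proof.
wlog lemn : m n / (m <= n)%N => [H mx nx|[z ->] [w]].
  by case: (leqP m n) => [/H|/ltnW/H H']; [exact | exact/esym/H'].
rewrite -(subnKC lemn) exprD -mulrA => /dyadic_lreg2X.
case: (n - m)%N => [|k]; first by rewrite addn0.
rewrite exprS => zw; case: (@dyadic_odd_neq0 (z - 2 ^+ k * (1 + 2 * w))).
transitivity ((1 + 2 * z) - 2 * 2 ^+ k * (1 + 2 * w)); first by ring.
by rewrite zw subrr.
Qed.

(** * Maps acting as odometers *)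

(** The model is the translation by an odd multiple of [2 ^ s].  The two
    quantitative conditions are chosen so that [iter 2 G] satisfies them again,
    with [s.+1] for [s]. *)
Record odometer (A : set dyadic) (G : dyadic -> dyadic) (s : nat) : Prop := {
  odometer_stable : forall x, A x -> A (G x);
  odometer_step : forall x, A x -> exists w, G x = x + 2 ^+ s * (1 + 2 * w);
  odometer_slope : forall x y, A x -> A y ->
    exists w, G x - G y = (x - y) * (1 + 4 * w) }.

(** [G (G x) - x] is [G x - x] times [1] plus a slope of [G]; as slopes are 1
    modulo 4, this factor is twice an odd number. *)
Lemma odometer_sqr A G s : odometer A G s -> odometer A (iter 2 G) s.+1.
Proof.
move=> [stab step slope]; split=> [x /stab/stab //|x Ax|x y Ax Ay] /=.
  have [v Gx] := step x Ax; have [w GGx] := slope _ _ (stab x Ax) Ax.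
  exists (v + w + 2 * v * w).
  rewrite -[LHS](subrK (G x)) GGx {2}Gx Gx exprS; ring.
have [v xy] := slope _ _ Ax Ay; have [w ->] := slope _ _ (stab x Ax) (stab y Ay).
by exists (v + w + 4 * v * w); rewrite xy; ring.
Qed.

Lemma odometer_iter A G s x j : odometer A G s -> A x ->
  A (iter j G x) /\ exists w, iter j G x = x + 2 ^+ s * (j%:R + 2 * w).
Proof.
move=> [stab step _] Ax; elim: j => [|j [Ay [w IH]]] /=.
  by split=> //; exists 0; ring.
split; first exact: stab.
have [v ->] := step _ Ay; exists (v + w); rewrite IH -natr1; ring.
Qed.

(** An odd number of steps moves [x] by an odd multiple of [2 ^ s]; an even
    number of steps of [G] is half as many steps of its square. *)
Lemma odometer_aperiodic A G s x j :
  odometer A G s -> A x -> (0 < j)%N -> iter j G x <> x.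
Proof.
elim/ltn_ind: j G s => j IH G s Gs Ax j0.
have := odd_double_half j; case: (odd j) => /= jE.
  have [_ [w ->]] := odometer_iter j Gs Ax => /(congr1 (fun y => y - x)).
  rewrite subrr -jE natrD -muln2 natrM => eq0.
  apply: (@dyadic_odd_neq0 (j./2%:R + w)); apply: (@dyadic_lreg2X s).
  rewrite mulr0 -eq0; ring.
rewrite -jE add0n -muln2 iterM; apply: IH (odometer_sqr Gs) Ax _; lia.
Qed.

(** One more binary digit is adjusted at each stage: if the target differs from
    [x] by an odd multiple of [2 ^ s], one step of [G] makes them agree modulo
    [2 ^ s.+1], and from then on the square of [G] is used. *)
Lemma odometer_dense A G s x z n : odometer A G s -> A x ->
  exists i y, x + 2 ^+ s * z = iter i G x + 2 ^+ (s + n) * y.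
Proof.
elim: n G s x z => [|n IH] G s x z Gs Ax.
  by exists 0%N, z; rewrite addn0.
have [y [->|->]] := dyadic_parity z.
  have [i [w E]] := IH _ _ _ y (odometer_sqr Gs) Ax.
  by exists (i * 2)%N, w; rewrite iterM addnS -addSn -E exprS; ring.
have [v Gx] := odometer_step Gs Ax.
have [i [w E]] := IH _ _ _ (y - v) (odometer_sqr Gs) (odometer_stable Gs Ax).
exists (i * 2).+1%N, w; rewrite iterSr iterM addnS -addSn -E Gx exprS; ring.
Qed.

(** * Polynomials and Fibonacci polynomials near the origin *)

Lemma horner_slope (A : comNzRingType) (p : {poly A}) x y :
  exists w, p.[x] - p.[y] = (x - y) * w.
Proof.
elim/poly_ind: p => [|p c [w IH]]; first by exists 0; rewrite !horner0; ring.
exists (p.[x] + w * y); rewrite !hornerMXaddC.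
transitivity (p.[x] * (x - y) + (p.[x] - p.[y]) * y); first by ring.
rewrite IH; ring.
Qed.

Lemma fib_polySS (A : nzRingType) n :
  fib_poly A n.+2 = 'X * fib_poly A n.+1 + fib_poly A n.
Proof. by []. Qed.

(** The degree 4 coefficient of the odd-indexed polynomials is left unknown, since
    it only contributes to the degree 5 term of the next even-indexed one. *)
Lemma fib_poly_low (A : comNzRingType) n : exists P Q : {poly A},
  fib_poly A n.*2 = n%:R * 'X + 'C(n.+1, 3)%:R * 'X^3 + 'X^5 * P /\
  fib_poly A n.*2.+1 = 1 + 'C(n.+1, 2)%:R * 'X^2 + 'X^4 * Q.
Proof.
elim: n => [|n [P [Q [IHe IHo]]]].
  by exists 0, 0; rewrite !bin_small //=; split; ring.
have Fe : fib_poly A n.+1.*2 =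
    n.+1%:R * 'X + 'C(n.+2, 3)%:R * 'X^3 + 'X^5 * (P + Q).
  rewrite doubleS fib_polySS IHe IHo (binS n.+1 2) natrD; ring.
exists (P + Q), ('C(n.+2, 3)%:R + 'X^2 * (P + Q) + Q); split=> //.
rewrite doubleS fib_polySS -doubleS Fe IHo (binS n.+1 1) bin1 natrD; ring.
Qed.

(** [(4 + 24 d) (3 + 24 d) (2 + 24 d) / 6 = 4 (1 + 6 d) (1 + 8 d) (1 + 12 d)]. *)
Lemma bin_dvd4 d : exists c, 'C((3 + 24 * d).+1, 3) = (4 * c)%N.
Proof.
exists ((1 + 6 * d) * (1 + 8 * d) * (1 + 12 * d))%N.
apply/eqP; rewrite -(eqn_pmul2r (fact_gt0 3)) bin_ffact.
by rewrite (_ : 3`! = 6)%N // !ffactnS ffactn0 /=; apply/eqP; nia.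
Qed.

(** At even points the term in [X^5] contributes a multiple of 16 to the slope,
    and so does the term in [X^3], whose coefficient is divisible by 4. *)
Lemma fib_poly_slope_even (A : comNzRingType) d (x y : A) : exists w,
  (fib_poly A (6 + 12 * (4 * d))).[2 * x] -
  (fib_poly A (6 + 12 * (4 * d))).[2 * y] =
  (2 * x - 2 * y) * (3 + 8 * (3 * d%:R) + 16 * w).
Proof.
have -> : (6 + 12 * (4 * d) = (3 + 24 * d).*2)%N by lia.
have [P [_ [-> _]]] := fib_poly_low A (3 + 24 * d).
have [c ->] := bin_dvd4 d; have [w xy] := horner_slope P (2 * x) (2 * y).
(* The three terms come from [X^3], from the slope of [P] and from that of
   [X^5]; each has been divided by 16. *)
exists (c%:R * (x ^+ 2 + x * y + y ^+ 2) + 2 * x ^+ 5 * w +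
  (x ^+ 4 + x ^+ 3 * y + x ^+ 2 * y ^+ 2 + x * y ^+ 3 + y ^+ 4) * P.[2 * y]).
rewrite -!polyC_natr !(hornerD, hornerM, hornerXn, hornerX, hornerC).
have -> : P.[2 * x] = P.[2 * y] + (2 * x - 2 * y) * w by rewrite -xy; ring.
rewrite natrD !natrM; ring.
Qed.

(** At 1 the polynomials take the Fibonacci numbers as values, and these satisfy
    [F_(k+3) = 2 F_(k+1) + F_k]. *)
Lemma fib_poly_at1_even (A : comNzRingType) n :
  exists w, (fib_poly A (3 * n)).[1] = 2 * w.
Proof.
elim: n => [|n [w IH]]; first by exists 0; rewrite horner0; ring.
exists (w + (fib_poly A (3 * n).+1).[1]).
rewrite mulnS !addSn add0n !fib_polySS !(hornerD, hornerM, hornerX) IH; ring.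
Qed.

Lemma fib_poly_even_at0 (A : comNzRingType) n : (fib_poly A n.*2).[0] = 0.
Proof.
elim: n => [|n IH]; first by rewrite horner0.
by rewrite doubleS fib_polySS hornerD hornerM hornerX mul0r add0r.
Qed.

(** * The sets [M_set n k] *)

Lemma M_setP n k x : M_set n k x <-> exists z,
  x = 2 ^+ n * (1 + 4 * k%:R + 8 * z) \/ x = 2 ^+ n * (3 + 4 * k%:R + 8 * z).
Proof.
rewrite /M_set /dyadic_coset exprD; split.
  by move=> [[z _ <-]|[z _ <-]]; exists z; [left|right]; ring.
by move=> [z [->|->]]; [left|right]; exists z => //; ring.
Qed.

Lemma M_set_shell n k x : M_set n k x -> dyadic_shell n x.
Proof.
move=> /M_setP[z [->|->]].
  by exists (2 * k%:R + 4 * z); congr (_ * _); ring.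
by exists (1 + 2 * k%:R + 4 * z); congr (_ * _); ring.
Qed.

Lemma shell_M_set n x :
  dyadic_shell n x -> exists2 k, (k <= 1)%N & M_set n k x.
Proof.
move=> [z ->]; have [y [->|->]] := dyadic_parity z;
  have [w [->|->]] := dyadic_parity y.
- by exists 0%N => //; apply/M_setP; exists w; left; congr (_ * _); ring.
- by exists 1%N => //; apply/M_setP; exists w; left; congr (_ * _); ring.
- by exists 0%N => //; apply/M_setP; exists w; right; congr (_ * _); ring.
- by exists 1%N => //; apply/M_setP; exists w; right; congr (_ * _); ring.
Qed.

(** The exponent is the valuation of [x], and the second index is determined by
    its unit part modulo 8. *)
Lemma M_set_inj m n k l x : (k <= 1)%N -> (l <= 1)%N ->
  M_set m k x -> M_set n l x -> (m, k) = (n, l).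
Proof.
move=> k1 l1 mk nl; have mn := dyadic_shell_inj (M_set_shell mk) (M_set_shell nl).
move: mk nl; rewrite {}mn => /M_setP[z zP] /M_setP[w wP]; congr pair.
have res (a b : nat) (u v : dyadic) :
    a%:R + 8 * u = b%:R + 8 * v -> (a %% 8 = b %% 8)%N.
  move=> /(congr1 (residue^~ 3%N)).
  rewrite !residueD !residueM !residue_nat !modnn !mul0n !mod0n.
  by rewrite !addn0 !modn_mod.
have {}res (a b : nat) : x = 2 ^+ n * (a%:R + 4 * k%:R + 8 * z) ->
    x = 2 ^+ n * (b%:R + 4 * l%:R + 8 * w) ->
    ((a + 4 * k) %% 8 = (b + 4 * l) %% 8)%N.
  move=> -> /dyadic_lreg2X E; apply: (res _ _ z w).
  move: E; rewrite [(a + _)%:R]natrD [(b + _)%:R]natrD !natrM; exact.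
case: zP wP => zE [] wE.
- by have := res 1%N 1%N zE wE; lia.
- by have := res 1%N 3%N zE wE; lia.
- by have := res 3%N 1%N zE wE; lia.
- by have := res 3%N 3%N zE wE; lia.
Qed.

(** * Maps that are close to multiplication by three on even points *)

(** The class [3 + 8 * e] of the slope modulo 16 has to be the same for all
    pairs: slopes 3 and 11 have product 33, and a product of two slopes must be
    9, rather than 1, modulo 16 for the second iterate to move points of
    valuation [n] by an odd multiple of [2 ^ (n + 3)]. *)
Record tripling_map (f : dyadic -> dyadic) (e : dyadic) : Prop := {
  tripling_slope : forall x y, exists w,
    f (2 * x) - f (2 * y) = (2 * x - 2 * y) * (3 + 8 * e + 16 * w);
  tripling0 : f 0 = 0;
  tripling_odd : forall z, exists w, f (1 + 2 * z) = 2 * w }.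

Lemma tripling_fib_poly d :
  tripling_map (fun x => (fib_poly dyadic (6 + 12 * (4 * d))).[x]) (3 * d%:R).
Proof.
split=> [x y||z]; first exact: fib_poly_slope_even.
  have -> : (6 + 12 * (4 * d) = (3 + 24 * d).*2)%N by lia.
  exact: fib_poly_even_at0.
set m := (6 + _)%N; have mE : m = (3 * (2 + 16 * d))%N by rewrite /m; lia.
have [w E] := horner_slope (fib_poly dyadic m) (1 + 2 * z) 1.
have [v E1] := fib_poly_at1_even dyadic (2 + 16 * d).
exists (v + z * w); rewrite -[LHS](subrK (fib_poly dyadic m).[1]) E mE E1; ring.
Qed.

Section TriplingMap.
Variables (f : dyadic -> dyadic) (e : dyadic).
Hypothesis fT : tripling_map f e.

Lemma tripling_mul x : exists w, f (2 * x) = 2 * x * (3 + 8 * e + 16 * w).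
Proof.
have [w E] := tripling_slope fT x 0; exists w.
by move: E; rewrite mulr0 (tripling0 fT) !subr0.
Qed.

Lemma tripling_even x : exists w, f x = 2 * w.
Proof.
have [z [->|->]] := dyadic_parity x; last exact: tripling_odd fT z.
by have [w ->] := tripling_mul z; eexists; rewrite -mulrA.
Qed.

Lemma tripling_shell n x : dyadic_shell n.+1 x -> dyadic_shell n.+1 (f x).
Proof.
move=> [z ->]; rewrite exprS -mulrA.
have [w ->] := tripling_mul (2 ^+ n * (1 + 2 * z)).
exists (1 + 4 * e + 8 * w + z * (3 + 8 * e + 16 * w)); rewrite exprS; ring.
Qed.

Lemma tripling_odometer n : odometer (dyadic_shell n.+1) (iter 2 f) (n.+1 + 3).
Proof.
have even x : dyadic_shell n.+1 x -> exists y, x = 2 * y.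
  by move=> [z ->]; exists (2 ^+ n * (1 + 2 * z)); rewrite exprS mulrA.
split=> [x /tripling_shell/tripling_shell //|x Ax|x y Ax Ay] /=.
  have [x' xE] := even _ Ax; have [w fx] := tripling_mul x'.
  have [y' yE] := even _ (tripling_shell Ax); have [v ffx] := tripling_mul y'.
  have [z E] := Ax.
  (* [t] is the number such that the two slopes have product [9 + 16 * t]. *)
  pose t := 3 * e + 3 * w + 3 * v + 8 * e * w + 8 * e * v + 16 * w * v +
    4 * e ^+ 2.
  exists (z + t * (1 + 2 * z)).
  rewrite yE ffx -yE xE fx -xE E exprD /t; ring.
have [x' xE] := even _ Ax; have [y' yE] := even _ Ay.
have [x1 x1E] := even _ (tripling_shell Ax).
have [y1 y1E] := even _ (tripling_shell Ay).
have [w wE] := tripling_slope fT x' y'.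
have [v vE] := tripling_slope fT x1 y1.
(* With [t] as above, the witness is [(9 + 16 * t - 1) / 4 = 2 + 4 * t]. *)
exists (2 + 12 * e + 12 * w + 12 * v + 32 * e * w + 32 * e * v +
  64 * w * v + 16 * e ^+ 2).
rewrite x1E y1E vE -x1E -y1E xE yE wE; ring.
Qed.

(** The residues 1, 3 modulo 8 are exchanged by multiplication by 3, and so are
    5, 7: this is where the pairing of cosets in [M_set n k] comes from. *)
Lemma tripling_swap n k z : (k <= 1)%N ->
  (exists w, f (2 ^+ n.+1 * (1 + 4 * k%:R + 8 * z)) =
             2 ^+ n.+1 * (3 + 4 * k%:R + 8 * w)) /\
  (exists w, f (2 ^+ n.+1 * (3 + 4 * k%:R + 8 * z)) =
             2 ^+ n.+1 * (1 + 4 * k%:R + 8 * w)).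
Proof.
have f3 y : exists w, f (2 ^+ n.+1 * y) = 2 ^+ n.+1 * (y * (3 + 8 * w)).
  rewrite exprS -mulrA; have [w ->] := tripling_mul (2 ^+ n * y).
  by exists (e + 2 * w); ring.
have [w E1] := f3 (1 + 4 * k%:R + 8 * z).
have [v E3] := f3 (3 + 4 * k%:R + 8 * z); rewrite E1 E3.
case: k {E1 E3} => [|[|//]] _; split.
- by exists (3 * z + w * (1 + 8 * z)); congr (_ * _); ring.
- by exists (1 + 3 * z + v * (3 + 8 * z)); congr (_ * _); ring.
- by exists (1 + 3 * z + w * (5 + 8 * z)); congr (_ * _); ring.
- by exists (2 + 3 * z + v * (7 + 8 * z)); congr (_ * _); ring.
Qed.

Lemma M_set_invariant n k x :
  (k <= 1)%N -> M_set n.+1 k x -> M_set n.+1 k (f x).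
Proof.
move=> k1 /M_setP[z zP]; have [[w fw] [v fv]] := tripling_swap n z k1.
apply/M_setP; case: zP => ->; first by exists w; right.
by exists v; left.
Qed.

(** The two cosets forming [M_set n k] are exchanged by [f], so that the
    target lies in the coset of the starting point or of its image. *)
Lemma M_set_dense n k x t N : (k <= 1)%N ->
  M_set n.+1 k x -> M_set n.+1 k t ->
  exists i, residue (t - iter i f x) N = 0%N.
Proof.
move=> k1 Mx Mt; have Ax := M_set_shell Mx.
have Gf := tripling_odometer n.
suff reach y : dyadic_shell n.+1 y ->
    (exists z, t = y + 2 ^+ (n.+1 + 3) * z) ->
    exists i, residue (t - iter i f y) N = 0%N.
  have Afx := tripling_shell Ax.
  suff [tx|tfx] : (exists z, t = x + 2 ^+ (n.+1 + 3) * z) \/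
      exists z, t = f x + 2 ^+ (n.+1 + 3) * z.
  - exact: reach tx.
  - by have [i ti] := reach _ Afx tfx; exists i.+1; rewrite iterSr.
  have /M_setP[z zP] := Mx; have /M_setP[y yP] := Mt.
  have [[w fw] [v fv]] := tripling_swap n z k1; rewrite exprD.
  case: zP yP => -> [] ->.
  - by left; exists (y - z); ring.
  - by right; exists (y - w); rewrite fw; ring.
  - by right; exists (y - v); rewrite fv; ring.
  - by left; exists (y - z); ring.
move=> Ay [z ->].
have [i [w ->]] := odometer_dense z N Gf Ay.
exists (i * 2)%N; rewrite iterM addrAC subrr add0r.
apply: (@residue_eq0_le _ _ (n.+1 + 3 + N)); first exact: leq_addl.
by apply/residue_eq0P; exists w.
Qed.

(** A point with [iter j f x = x] also satisfies [iter j (iter 2 f) x = x]. *)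
Lemma tripling_aperiodic n x j :
  dyadic_shell n.+1 x -> (0 < j)%N -> iter j f x <> x.
Proof.
move=> Ax j0 fx; apply: (odometer_aperiodic (tripling_odometer n) Ax j0).
by rewrite -iterM mulnC iterM /= fx fx.
Qed.

End TriplingMap.

(** * Topology of the dyadic integers *)

Lemma residueB_sym (x y : dyadic) N :
  residue (x - y) N = 0%N -> residue (y - x) N = 0%N.
Proof. by move=> /eqP; rewrite -residueN_eq0 opprB => /eqP. Qed.

Lemma dyadic_nbhsP (x : dyadic) (B : set dyadic) :
  nbhs x B <-> exists N, forall y, residue (x - y) N = 0%N -> B y.
Proof.
split=> [/nbhsP[E [N EN] EB]|[N NB]].
  by exists N => y xy; apply: EB; exact/xsectionP/EN.
apply/nbhsP; exists [set p | residue (p.1 - p.2) N = 0%N]; first by exists N.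
by move=> y /xsectionP /NB.
Qed.

Lemma dyadic_closureP (A : set dyadic) (x : dyadic) :
  closure A x <-> forall N, exists2 y, A y & residue (x - y) N = 0%N.
Proof.
split=> [Ax N|Ax B /dyadic_nbhsP[N NB]].
  have [y [Ay xy]] := Ax _ ((dyadic_nbhsP x _).2 (ex_intro _ N (fun y => id))).
  by exists y.
by have [y Ay xy] := Ax N; exists y; split=> //; exact: NB.
Qed.

(** A union of classes modulo [2 ^ N] is clopen. *)
Lemma dyadic_clopen (A : set dyadic) N :
  (forall x y, A x -> residue (x - y) N = 0%N -> A y) -> clopen A.
Proof.
move=> AN; split.
  by rewrite openE => x Ax; apply/dyadic_nbhsP; exists N => y; exact: AN.
move=> x /dyadic_closureP/(_ N)[y Ay xy].
exact: AN Ay (residueB_sym xy).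
Qed.

Lemma dyadic_coset_residue (a : dyadic) n x :
  dyadic_coset a n x <-> residue (a - x) n = 0%N.
Proof.
split=> [[z _ <-]|/residueB_sym/residue_eq0P[z xz]].
  by apply/residue_eq0P; exists (- z); ring.
by exists z => //; rewrite -xz; ring.
Qed.

Lemma dyadic_coset_clopen (a : dyadic) n : clopen (dyadic_coset a n).
Proof.
apply: (@dyadic_clopen _ n) => x y /dyadic_coset_residue ax xy.
by apply/dyadic_coset_residue; rewrite -(subrKA x); exact: residueD_eq0.
Qed.

Lemma M_set_clopen n k : clopen (M_set n k).
Proof. by apply: clopenU; exact: dyadic_coset_clopen. Qed.

(** The ball is open, which is why its radius is [2^-n] and not [2^-(n+1)]. *)
Lemma dyadic_coset_ball (R : realType) (a : dyadic) n :
  dyadic_coset a n.+1 = ball a (2^-1 ^+ n : R).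
Proof.
apply/seteqP; split=> x; rewrite /ball /= /dyadic_ball /=.
  move=> /dyadic_coset_residue ax; apply: (@le_lt_trans _ _ (2^-1 ^+ n.+1)).
    by rewrite /dyadic_dist dyadic_abs_le ax.
  by rewrite ltr_iXn2l ?invr_gt0 // invf_lt1 ?ltr1n.
rewrite /dyadic_dist => lt_n; apply/dyadic_coset_residue.
have [[-> _]|[m [E am _]]] := dyadic_absP R (a - x); first exact: residue0.
move: lt_n; rewrite E ltr_iXn2l ?invr_gt0 ?invf_lt1 ?ltr1n // => lt_n.
exact: residue_eq0_le lt_n am.
Qed.

(** * Minimal components and basins *)

Lemma attracting_basin_entry (R : realType) (T : metricType R) (g : T -> T)
    (C : set T) x :
  g @` C `<=` C -> C (g x) -> attracting_basin g C x.
Proof.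
move=> gC Cgx; apply: cvg_near_cst; near=> n.
have Cn : C (iter n g x).
  have [m ->] : exists m, n = m.+1.
    by exists n.-1; rewrite prednK //; near: n; exists 1%N.
  elim: m => //= m IH; apply: gC; exact: imageP.
apply/eqP; rewrite eq_le; apply/andP; split.
  apply: ge_inf; last by exists (iter n g x) => //; rewrite mdistxx.
  by exists 0 => _ [c _ <-]; exact: mdist_ge0.
apply: lb_le_inf; first by exists 0; exists (iter n g x) => //; rewrite mdistxx.
by move=> _ [c _ <-]; exact: mdist_ge0.
Unshelve. all: by end_near. Qed.

Section Components.
Variables (R : realType) (f : dyadic -> dyadic) (e : dyadic).
Hypothesis fT : tripling_map f e.
Let D : set (nat * nat) := [set i | (1 <= i.1)%N /\ (i.2 <= 1)%N].

Lemma M_set_minimal_component n k : (k <= 1)%N ->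
  @minimal_component R dyadic f (M_set n.+1 k).
Proof.
move=> k1; split.
- exists (2 ^+ n.+1 * (1 + 4 * k%:R + 8 * 0)).
  by apply/M_setP; exists 0; left.
- exact: M_set_clopen.
- by move=> _ [x Mx <-]; exact: M_set_invariant fT _ _ _ k1 Mx.
- pose r : R := 2^-1 ^+ (n.+1 + 2).
  exists [set ((1 + 4 * k)%:R * 2 ^+ n.+1, r); ((3 + 4 * k)%:R * 2 ^+ n.+1, r)].
  split; first exact: finite_set2.
    by move=> p [->|->] /=; rewrite exprn_gt0 ?invr_gt0.
  by rewrite bigcup_setU !bigcup_set1 /= -!dyadic_coset_ball -addnS.
move=> x Mx t Mt; apply/dyadic_closureP => N.
have [i ti] := M_set_dense fT N k1 Mx Mt.
by exists (iter i f x) => //; exists i.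
Qed.

Lemma even_zero_or_M_set w : 2 * w = 0 \/ exists2 i, D i & M_set i.1 i.2 (2 * w).
Proof.
have [->|/eqP w0] := eqVneq (2 * w) 0; [by left|right].
have [n An] := dyadic_neq0_shell w0.
have [k k1 Mx] := shell_M_set An.
exists (n, k) => //; split=> //=; case: n An {Mx} => // -[z].
rewrite expr0 mul1r => E; case: (@dyadic_odd_neq0 (z - w)).
transitivity (1 + 2 * z - 2 * w); first by ring.
by rewrite E subrr.
Qed.

(** The orbit of 0 is reduced to 0, whereas an open set containing 0 contains
    high powers of 2. *)
Lemma zero_not_component C : @minimal_component R dyadic f C -> ~ C 0.
Proof.
move=> [_ [oC _] _ _ Cmin] C0.
have /dyadic_nbhsP[N NC] : nbhs (0 : dyadic) C by exact: open_nbhs_nbhs.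
have CN : C (2 ^+ N).
  by apply/NC/residueB_sym/residue_eq0P; exists 1; rewrite subr0 mulr1.
have /dyadic_closureP/(_ N.+1)[_ [i _ <-]] := Cmin _ C0 _ CN.
have -> : iter i f 0 = 0 by elim: i => //= i ->; exact: tripling0 fT.
rewrite subr0 => /residue_eq0P[z].
rewrite exprSr -mulrA -[LHS]mulr1 => /dyadic_lreg2X E.
by apply: (@dyadic_odd_neq0 (- z)); rewrite mulrN -E subrr.
Qed.

Lemma closure_orbit_sub (C : set dyadic) x : closed C ->
  f @` C `<=` C -> C x -> closure (@forward_orbit R dyadic f x) `<=` C.
Proof.
move=> clC fC Cx; have sub : @forward_orbit R dyadic f x `<=` C.
  by move=> _ [i _ <-]; elim: i => //= i IH; apply: fC; exact: imageP.
by move=> t /(closureS sub); rewrite -((closure_id C).1 clC).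
Qed.

(** Any component contains an even point, namely the image of any of its points;
    two minimal components that share a point are both the closure of its
    orbit. *)
Lemma minimal_components_tripling :
  [set C | @minimal_component R dyadic f C] = (fun i => M_set i.1 i.2) @` D.
Proof.
apply/seteqP; split=> [C Cmc|_ [[n k] [/= n0 k1] <-]] /=; last first.
  by rewrite -(prednK n0); exact: M_set_minimal_component.
have [[x Cx] [_ clC] fC _ Cmin] := Cmc.
have Cfx : C (f x) by apply: fC; exact: imageP.
have [w fx] := tripling_even fT x.
have [fx0|[i Di Mi]] := even_zero_or_M_set w.
  by case: (zero_not_component Cmc); rewrite -fx0 -fx.
exists i => //; case: i Di Mi => n k [/= n0 k1].
rewrite -fx -(prednK n0) => Mfx.
have [_ [_ clM] fM _ Mmin] := M_set_minimal_component n.-1 k1.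
apply/seteqP; split.
  by apply: subset_trans (Mmin _ Mfx) _; exact: closure_orbit_sub.
by apply: subset_trans (Cmin _ Cfx) _; exact: closure_orbit_sub.
Qed.

End Components.

Theorem theorem7p3 (R : realType) (m q d : nat)
    (hm : m = (6 + 12 * q)%N) (hq : q = (4 * d)%N) :
  let f : dyadic -> dyadic := fun x => (fib_poly dyadic m).[x] in
  let D : set (nat * nat) := [set i | (1 <= i.1)%N /\ (i.2 <= 1)%N] in
  let M : nat * nat -> set dyadic := fun i => M_set i.1 i.2 in
  let B : set dyadic := dyadic_coset 1 1 in
  [/\ @minimal_decomposition R dyadic f [set 0] (nat * nat)%type D M B,
      f 0 = 0,
      clopen B &
      forall x, B x ->
        @attracting_basin R dyadic f [set 0] x \/
        exists2 i, D i & @attracting_basin R dyadic f (M i) x].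
Proof.
move=> f D M B.
have fT : tripling_map f (3 * d%:R).
  by rewrite /f hm hq; exact: tripling_fib_poly.
have f0 : f 0 = 0 := tripling0 fT.
have B_odd x : B x <-> exists z, x = 1 + 2 * z.
  by rewrite /B /dyadic_coset expr1; split=> [[z _ <-]|[z ->]]; exists z.
have not_B_even z : ~ B (2 * z).
  move=> /B_odd[w zw]; apply: (@dyadic_odd_neq0 (w - z)).
  by transitivity (1 + 2 * w - 2 * z); [ring | rewrite zw subrr].
have M_even i x : D i -> M i x -> exists z, x = 2 * z.
  case: i => -[|n] k [//= _ _] /M_set_shell[z ->].
  by eexists; rewrite exprS -mulrA.
have MX i : D i -> @minimal_component R dyadic f (M i).
  move=> Di; suff : [set C | @minimal_component R dyadic f C] (M i) by [].
  by rewrite (minimal_components_tripling R fT); exists i.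
have orbit0 : @forward_orbit R dyadic f 0 = [set 0].
  have iter0 n : iter n f 0 = 0 by elim: n => //= n ->.
  by apply/seteqP; split=> [_ [n _ <-]|_ ->] /=; [exact: iter0|exists 0%N].
have per0 : @periodic_points R dyadic f 0 by exists 1%N.
have basin x : @attracting_basin R dyadic f [set 0] x \/
    exists2 i, D i & @attracting_basin R dyadic f (M i) x.
  have [w fx] := tripling_even fT x.
  have [fx0|[i Di Mi]] := even_zero_or_M_set w; [left|right].
    apply: attracting_basin_entry; first by move=> _ [_ -> <-]; exact: f0.
    by rewrite fx fx0.
  exists i => //; apply: attracting_basin_entry; last by rewrite fx.
  exact: mc_invariant (MX i Di).
split=> //; last exact: dyadic_coset_clopen.
split.
- apply/seteqP; split=> // x _; have [w [->|->]] := dyadic_parity x.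
    by left; have [->|[i Di Mi]] := even_zero_or_M_set w; [left|right; exists i].
  by right; apply/B_odd; exists w.
- apply/seteqP; split=> // _ [-> [i Di /M_set_shell/dyadic_shell_neq0]]; exact.
- apply/seteqP; split=> // _ [-> B0]; case: (not_B_even 0).
  by rewrite mulr0.
- apply/seteqP; split=> // x [[i Di /(M_even _ _ Di)[z ->]]]; exact: not_B_even.
- exact: finite_set1.
- apply/seteqP; split=> [_ -> //|x [j j0 fx]].
  have [w xw] : exists w, x = 2 * w.
    by rewrite -fx -(prednK j0) iterS; exact: tripling_even fT _.
  have [w0|[[[|n] k] [//= _ _]]] := even_zero_or_M_set w; first by rewrite xw.
  by rewrite -xw => /M_set_shell/(tripling_aperiodic fT)/(_ j0 fx).
- exact: countableP.
- move=> [m1 k1] [m2 k2] [_ /= k1P] [_ /= k2P] [x [/= M1 M2]].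
  exact: M_set_inj k1P k2P M1 M2.
- by rewrite (minimal_components_tripling R fT).
- move=> x _; have [x0|[i Di xi]] := basin x.
    by exists [set 0]; split=> //; left; exists 0.
  by exists (M i); split=> //; right; exact: MX.
Qed.
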